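(* The generating function of the Bernoulli numbers $B_n$ has the continued fraction expansion $$\sum_{n=0}^\infty B_{n}\frac{x^n}{n!}=1-\cfrac{x}{2+x-\cfrac{2x}{3+x-\cfrac{3x}{4+x-\cfrac{4x}{5+x-\ddots}}}}\,,$$ i.e. the continued fraction $a_0+\cfrac{b_1}{a_1+\cfrac{b_2}{a_2+\ddots}}$ with $a_0=1$, $b_1=-x$, $a_n=n+1+x$ for $n\ge 1$, and $b_n=-nx$ for $n\ge 2$.
   Context: The Bernoulli numbers $B_n$ are defined by $\frac{x}{e^x-1}=\sum_{n=0}^\infty B_n\frac{x^n}{n!}$ (so $B_1=-1/2$). Convention on continued fractions: for polynomials $a_n$ ($n\ge 0$), $b_n$ ($n\ge 1$) in $x$, the convergents $P_n/Q_n$ of $a_0+\cfrac{b_1}{a_1+\cfrac{b_2}{a_2+\ddots}}$ are defined by $P_{-1}=1$, $Q_{-1}=0$, $P_0=a_0$, $Q_0=1$, $P_n=a_nP_{n-1}+b_nP_{n-2}$, $Q_n=a_nQ_{n-1}+b_nQ_{n-2}$ ($n\ge 1$). A formal power series $f(x)$ has this continued fraction expansion (written as an equality) if for every $n\ge 0$ the power series expansion at $x=0$ of $P_n(x)/Q_n(x)$ agrees with $f(x)$ up to and including the term in $x^n$, i.e. $P_n/Q_n\equiv f\pmod{x^{n+1}}$; in particular $f=\lim_{n\to\infty}P_n/Q_n$ as formal power series. *)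

(* Defs.v *)
From mathcomp Require Import all_boot all_order all_algebra.

Set Implicit Arguments.
Unset Strict Implicit.
Unset Printing Implicit Defensive.

Import Order.TTheory GRing.Theory Num.Theory.
Local Open Scope ring_scope.

(* A formal power series over F is represented by its coefficient sequence
   nat -> F; equality of series is pointwise equality =1. *)

Definition fps_mul (F : fieldType) (f g : nat -> F) : nat -> F :=
  fun n => \sum_(i < n.+1) f i * g (n - i)%N.

Definition fps_poly (F : fieldType) (p : {poly F}) : nat -> F := fun n => p`_n.

(* f is the power series g / h. Neither h 0 != 0 nor coprimality is required,
   so that x / (e^x - 1) makes sense; by fps_quot_uniq there is at most one
   such f. *)
Definition fps_quot (F : fieldType) (g h f : nat -> F) : Prop :=
  (exists k, h k != 0) /\ fps_mul h f =1 g.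

Lemma fps_quot_uniq (F : fieldType) (g h f f' : nat -> F) :
  fps_quot g h f -> fps_quot g h f' -> f =1 f'.
Proof.
case=> [exh hf] [_ hf'].
case: (ex_minnP exh) => k hk kmin.
elim/ltn_ind => n IHn.
have e : fps_mul h f (k + n)%N = fps_mul h f' (k + n)%N by rewrite hf hf'.
have lek : (k < (k + n).+1)%N by rewrite ltnS leq_addr.
move: e; rewrite /fps_mul (bigD1 (Ordinal lek)) //= [RHS](bigD1 (Ordinal lek)) //= addKn.
suff -> : \sum_(i < (k + n).+1 | i != Ordinal lek) h i * f (k + n - i)%N =
          \sum_(i < (k + n).+1 | i != Ordinal lek) h i * f' (k + n - i)%N.
  by move/addIr/(mulfI hk).
apply: eq_bigr => i; rewrite -val_eqE /= => nik.
case: (ltngtP i k) nik => // [ltik | ltki] _.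
  have -> : h i = 0 by apply/eqP/negPn/negP => /kmin; rewrite leqNgt ltik.
  by rewrite !mul0r.
rewrite IHn // ltn_subLR; last by rewrite -ltnS.
by rewrite ltn_add2r.
Qed.

(* fps_exp has terms x^n / n!; egf B is \sum_n B_n x^n / n!. *)
Definition egf (B : nat -> rat) : nat -> rat := fun n => B n / (n`!)%:R.

Definition fps_exp : nat -> rat := egf (fun=> 1).

(* B is the sequence of Bernoulli numbers:
   x / (e^x - 1) = \sum_n B_n x^n / n!  (so B_1 = -1/2). *)
Definition is_bernoulli (B : nat -> rat) : Prop :=
  fps_quot (fps_poly 'X) (fun n => fps_exp n - fps_poly 1 n) (egf B).

Lemma fps_exp_sub1 n : fps_exp n - fps_poly 1 n = (0 < n)%N%:R / (n`!)%:R.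
Proof.
rewrite /fps_exp /egf /fps_poly coef1.
by case: n => [|n]; rewrite ?fact0 ?divr1 ?subrr ?mul0r // subr0.
Qed.

Lemma is_bernoulli_uniq (B B' : nat -> rat) :
  is_bernoulli B -> is_bernoulli B' -> B =1 B'.
Proof.
move=> hB hB' n; have := fps_quot_uniq hB hB' n; rewrite /egf.
by apply: mulIf; rewrite invr_eq0 pnatr_eq0 -lt0n fact_gt0.
Qed.

Lemma is_bernoulli_ex : exists B, is_bernoulli B.
Proof.
pose c (n : nat) : rat := ((n.+1)`!)%:R^-1.
pose new (g : nat -> rat) n := (n == 0%N)%:R - \sum_(i < n) c i.+1 * g (n - i.+1)%N.
pose G := fix G m : nat -> rat := if m is m'.+1 then
  fun k => if k == m then new (G m') m else G m' k else fun=> 1.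
pose g n := G n n.
have Gg m k : (k <= m)%N -> G m k = g k.
  elim: m => [|m IHm]; first by rewrite leqn0 => /eqP ->.
  rewrite leq_eqVlt => /orP[/eqP -> // | ltkm].
  by rewrite /= ltn_eqF // IHm.
have gE n : g n = new g n.
  case: n => [|n]; first by rewrite /g /new /= big_ord0 subr0.
  rewrite {1}/g /= eqxx /new; congr (_ - _); apply: eq_bigr => i _.
  by rewrite Gg // subSS leq_subr.
exists (fun n => g n * (n`!)%:R); split.
  by exists 1%N; rewrite fps_exp_sub1.
move=> n; rewrite /fps_mul /fps_poly coefX big_ord_recl fps_exp_sub1 !mul0r add0r.
case: n => [|n]; first by rewrite big_ord0.
have E k : egf (fun n => g n * (n`!)%:R) k = g k.
  by rewrite /egf mulfK // pnatr_eq0 -lt0n fact_gt0.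
have b0 k : bump 0 k = k.+1 by [].
rewrite big_ord_recl fps_exp_sub1 E /= !b0 subSS subn0 factS fact0 muln1 divr1 mul1r.
rewrite gE /new eqSS -addrA -[RHS]addr0; congr (_ + _).
apply/eqP; rewrite addrC subr_eq0; apply/eqP; apply: eq_bigr => i _.
by rewrite fps_exp_sub1 E !b0 /= mul1r subSS.
Qed.

(* The pair (U_{n-1}, U_n) of the recurrence U_n = a_n U_{n-1} + b_n U_{n-2}
   (n >= 1) started from u = (U_{-1}, U_0); the value b 0 is never used. *)
Fixpoint cf_rec (F : fieldType) (a b : nat -> {poly F})
    (u : {poly F} * {poly F}) (n : nat) : {poly F} * {poly F} :=
  if n is m.+1 then
    let v := cf_rec a b u m in (v.2, a n * v.2 + b n * v.1)
  else u.

Definition cf_num (F : fieldType) (a b : nat -> {poly F}) (n : nat) : {poly F} :=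
  (cf_rec a b (1, a 0%N) n).2.

Definition cf_den (F : fieldType) (a b : nat -> {poly F}) (n : nat) : {poly F} :=
  (cf_rec a b (0, 1) n).2.

(* Every convergent P_n / Q_n has a power series expansion at 0, and it agrees
   with f modulo x^(n+1). *)
Definition has_cf_expansion (F : fieldType) (f : nat -> F)
    (a b : nat -> {poly F}) : Prop :=
  forall n, exists r : nat -> F,
    fps_quot (fps_poly (cf_num a b n)) (fps_poly (cf_den a b n)) r /\
    (forall k, (k <= n)%N -> r k = f k).

(* Main.v *)
Require Import Defs.
From mathcomp Require Import all_boot all_order all_algebra.
From mathcomp Require Import ring.
Import Order.TTheory GRing.Theory Num.Theory.
Local Open Scope ring_scope.

(** The recurrences have closed-form solutions: [P_n = (n+1)!], and
    [Q_n = (n+1)! * \sum_(k <= n) x^k / (k+1)!], because this [Q_n] satisfies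
    [Q_n = (n+1) Q_(n-1) + x^n].  Hence [Q_n / P_n] is the truncation of
    [(e^x - 1) / x] modulo [x^(n+1)]. *)

(** Each coefficient of a quotient depends on all earlier ones, so the recursion carries the whole
    list of them. *)
Fixpoint fps_div_seq {F : fieldType} (g h : nat -> F) (n : nat) : seq F :=
  if n is m.+1 then
    let s := fps_div_seq g h m in
    rcons s ((g m - \sum_(i < m) h i.+1 * s`_(m - i.+1)) / h 0%N)
  else [::].

Definition fps_div {F : fieldType} (g h : nat -> F) (n : nat) : F :=
  (fps_div_seq g h n.+1)`_n.

Lemma size_fps_div_seq (F : fieldType) (g h : nat -> F) n :
  size (fps_div_seq g h n) = n.
Proof. by elim: n => //= n IHn; rewrite size_rcons IHn. Qed.

(** Longer runs only append entries, so a coefficient never changes once computed. *)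
Lemma nth_fps_div_seq (F : fieldType) (g h : nat -> F) n k :
  (k < n)%N -> (fps_div_seq g h n)`_k = fps_div g h k.
Proof.
elim: n => // n IHn; rewrite ltnS leq_eqVlt => /orP[/eqP -> //|ltkn].
by rewrite /= nth_rcons size_fps_div_seq ltkn IHn.
Qed.

Lemma fps_mul_recl (F : fieldType) (h f : nat -> F) n :
  fps_mul h f n = h 0%N * f n + \sum_(i < n) h i.+1 * f (n - i.+1)%N.
Proof. by rewrite /fps_mul big_ord_recl subn0. Qed.

Lemma fps_divP (F : fieldType) (g h : nat -> F) :
  h 0%N != 0 -> fps_quot g h (fps_div g h).
Proof.
move=> h0; split; first by exists 0%N.
move=> n; rewrite fps_mul_recl {1}/fps_div /= nth_rcons size_fps_div_seq ltnn eqxx.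
rewrite mulrC divfK //; under eq_bigr => i _.
  by rewrite nth_fps_div_seq ?ltn_subrL ?(leq_ltn_trans _ (ltn_ord i)) //; over.
by rewrite subrK.
Qed.

(** Division modulo [x^(n+1)]: coefficient [k] of the product is [h 0 * f k] plus terms in earlier
    coefficients of [f], so strong induction cancels the invertible [h 0]. *)
Lemma fps_mul_inj_upto (F : fieldType) (h h' f f' : nat -> F) n :
  h 0%N != 0 -> (forall k, (k <= n)%N -> h k = h' k) ->
  (forall k, (k <= n)%N -> fps_mul h f k = fps_mul h' f' k) ->
  forall k, (k <= n)%N -> f k = f' k.
Proof.
move=> h0 eqh eqm; elim/ltn_ind => k IHk lekn.
move: (eqm k lekn); rewrite !fps_mul_recl -eqh //.
under eq_bigr => i _.
  rewrite eqh ?(leq_trans (ltn_ord i)) // IHk; first by over.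
    by rewrite ltn_subrL (leq_ltn_trans _ (ltn_ord i)).
  by rewrite (leq_trans (leq_subr _ _)).
by move/addIr/(mulfI h0).
Qed.

(** Since [e^x - 1] has no constant term, the defining identity can be divided by [x], which shifts
    its coefficients by one. *)
Lemma is_bernoulli_mul (B : nat -> rat) n : is_bernoulli B ->
  fps_mul (fun k => (k.+1)`!%:R^-1) (egf B) n = (n == 0%N)%:R.
Proof.
case=> _ /(_ n.+1); rewrite fps_mul_recl fps_exp_sub1 !mul0r add0r.
rewrite /fps_poly coefX eqSS => <-; apply: eq_bigr => i _.
by rewrite fps_exp_sub1 subSS mul1r.
Qed.

Lemma cf_recS (F : fieldType) (a b : nat -> {poly F}) u n :
  cf_rec a b u n.+1 =
  let v := cf_rec a b u n in (v.2, a n.+1 * v.2 + b n.+1 * v.1).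
Proof. by []. Qed.

Definition bernoulli_cf_a (n : nat) : {poly rat} :=
  if n == 0%N then 1 else (n.+1)%:R + 'X.

Definition bernoulli_cf_b (n : nat) : {poly rat} :=
  if n == 1%N then - 'X else - (n%:R * 'X).

Definition bernoulli_cf_q (n : nat) : {poly rat} :=
  \poly_(k < n.+1) ((n.+1)`!%:R / (k.+1)`!%:R).

Lemma bernoulli_cf_bE n : bernoulli_cf_b n = - (n%:R * 'X).
Proof. by rewrite /bernoulli_cf_b; case: eqP => // ->; rewrite mul1r. Qed.

(** Coefficients up to [x^n] scale by [(n+2)!/(n+1)! = n+2]; the new top one is
    [(n+2)!/(n+2)! = 1]. *)
Lemma bernoulli_cf_qS n :
  bernoulli_cf_q n.+1 = (n.+2)%:R * bernoulli_cf_q n + 'X^(n.+1).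
Proof.
apply/polyP => k; rewrite coefD mulr_natl coefMn !coef_poly coefXn ltnS.
case: ltngtP => [ltkn|ltnk|->]; rewrite ?mul0rn ?addr0 ?add0r //.
  by rewrite factS natrM -mulrA mulr_natl.
by rewrite divff // pnatr_eq0 -lt0n fact_gt0.
Qed.

(** In the inductive step the terms in [x] cancel, because [(n+2) * (n+1)! = (n+2)!]. *)
Lemma bernoulli_cf_recP n :
  cf_rec bernoulli_cf_a bernoulli_cf_b (1, bernoulli_cf_a 0) n.+1 =
  ((n.+1)`!%:R, (n.+2)`!%:R).
Proof.
elim: n => [|n IHn].
  rewrite /= /bernoulli_cf_a /bernoulli_cf_b /= !factS fact0; congr pair.
  ring.
rewrite cf_recS IHn /= bernoulli_cf_bE.
rewrite /bernoulli_cf_a /=; congr pair.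
by rewrite !(factS n.+2) !(factS n.+1) !natrM; ring.
Qed.

Lemma cf_num_bernoulli n :
  cf_num bernoulli_cf_a bernoulli_cf_b n = (n.+1)`!%:R.
Proof. by case: n => [//|n]; rewrite /cf_num bernoulli_cf_recP. Qed.

Lemma bernoulli_cf_q0 : bernoulli_cf_q 0 = 1.
Proof. by apply/polyP => -[|k]; rewrite coef_poly coef1 // divff. Qed.

(** The terms carrying the factor [x] combine to [x * (Q_(n+1) - (n+2) Q_n) = x^(n+2)], which turns
    the three-term recurrence into the two-term one. The index starts at [n.+1] because [Q_(-1) = 0]
    lies outside the family [bernoulli_cf_q]. *)
Lemma bernoulli_cf_recQ n :
  cf_rec bernoulli_cf_a bernoulli_cf_b (0, 1) n.+1 =
  (bernoulli_cf_q n, bernoulli_cf_q n.+1).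
Proof.
elim: n => [|n IHn].
  rewrite /= bernoulli_cf_qS bernoulli_cf_q0 /bernoulli_cf_a /=.
  by congr pair; ring.
rewrite cf_recS IHn /= bernoulli_cf_bE.
rewrite /bernoulli_cf_a /= (bernoulli_cf_qS n.+1); congr pair.
by rewrite bernoulli_cf_qS !exprS; ring.
Qed.

Lemma cf_den_bernoulli n :
  cf_den bernoulli_cf_a bernoulli_cf_b n = bernoulli_cf_q n.
Proof.
case: n => [|n]; last by rewrite /cf_den bernoulli_cf_recQ.
by rewrite bernoulli_cf_q0.
Qed.

Theorem corollary2 (B : nat -> rat) (hB : is_bernoulli B) :
  has_cf_expansion (egf B)
    (fun n => if n == 0%N then 1 else (n.+1)%:R + 'X)
    (fun n => if n == 1%N then - 'X else - (n%:R * 'X)).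
Proof.
rewrite -/bernoulli_cf_a -/bernoulli_cf_b => n.
rewrite cf_num_bernoulli cf_den_bernoulli.
set g := fps_poly _; set h := fps_poly _.
have hE k : (k <= n)%N -> h k = (n.+1)`!%:R / (k.+1)`!%:R.
  by move=> lekn; rewrite /h /fps_poly coef_poly ltnS lekn.
have h0 : h 0%N != 0.
  by rewrite hE // divr1 pnatr_eq0 -lt0n fact_gt0.
have [_ mulE] := fps_divP _ g h h0.
exists (fps_div g h); split; first exact: fps_divP.
(* Through [hE], the truncated divisor [Q_n] is compared with the full series
   [(n+1)! * (e^x - 1)/x], whose product with [egf B] is the constant [(n+1)! = P_n]. *)
apply: fps_mul_inj_upto h0 hE _ => k lekn; rewrite mulE.
transitivity ((n.+1)`!%:R * (k == 0%N)%:R : rat).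
  by rewrite /g /fps_poly -polyC_natr coefC; case: eqP; rewrite ?mulr1 ?mulr0.
rewrite -(is_bernoulli_mul _ k hB) /fps_mul mulr_sumr.
by apply: eq_bigr => i _; rewrite mulrA.
Qed.
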